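(* Let $\mathsf P=(\mathsf G,\mathsf M,\mathsf W)$ be a secure network coding problem in which $|O(s)|=1$ for every $s\in\mathcal S$, and let $q$ be a prime power. A rate-capacity tuple $(\lambda,\omega)$ is $0$-achievable subject to $q$-linearity and strong secrecy if and only if \[(\lambda,\omega)\in\mathsf{CL}\big(\mathrm{proj}_{\mathsf P}[\bar\Upsilon^*_q\cap\mathcal C_I(\mathsf P)\cap\mathcal C_T(\mathsf P)\cap\mathcal C_D(\mathsf P)\cap\mathcal C_S(\mathsf P)]\big).\]
   Context: A network is $\mathsf G=(\mathcal V,\mathcal E)$, $\mathcal V$ a finite set of nodes, $\mathcal E$ a finite set of hyperedges, each $e$ with tail $\mathrm{tail}(e)\in\mathcal V$ and head $\mathrm{head}(e)\subseteq\mathcal V$, without directed cycles. A connection constraint $\mathsf M=(\mathcal S,O,D)$: finite source index set $\mathcal S$, $O:\mathcal S\to2^{\mathcal V}$ (where source $s$ is available), $D:\mathcal S\to2^{\mathcal V}$ (sinks of $s$). Sources are imaginary edges with $\mathrm{head}(s)=O(s)$; $\mathrm{in}(e)=\{f\in\mathcal S\cup\mathcal E:\mathrm{tail}(e)\in\mathrm{head}(f)\}$, $\mathrm{in}(u)=\{f\in\mathcal S\cup\mathcal E:u\in\mathrm{head}(f)\}$. A wiretapping pattern is $\mathsf W=\{(\mathcal A_r,\mathcal B_r):r\in\mathcal R\}$ with $\mathcal R$ finite, $\mathcal A_r\subseteq\mathcal S$, $\mathcal B_r\subseteq\mathcal E$ (adversary $r$ observes the links in $\mathcal B_r$ and targets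 the sources in $\mathcal A_r$). A secure network coding problem is $\mathsf P=(\mathsf G,\mathsf M,\mathsf W)$. The sets $\mathcal S,\mathcal E,\mathcal V$ are treated as disjoint index sets. For a finite set $\mathcal N$, $\mathcal H[\mathcal N]$ is the set of real functions on subsets of $\mathcal N$; $g(\alpha\mid\beta)=g(\alpha\cup\beta)-g(\beta)$, $g(\alpha\wedge\beta)=g(\alpha)+g(\beta)-g(\alpha\cup\beta)$. Define subsets of $\mathcal H[\mathcal S\cup\mathcal E\cup\mathcal V]$: $\mathcal C_I(\mathsf P)=\{h:h(\mathcal S\cup\mathcal V)=\sum_{s\in\mathcal S}h(s)+\sum_{u\in\mathcal V}h(u)\}$; $\mathcal C_T(\mathsf P)=\{h:h(e\mid\mathrm{in}(e)\cup\{\mathrm{tail}(e)\})=0\ \forall e\in\mathcal E\}$; $\mathcal C_D(\mathsf P)=\{h:h(s\mid\mathrm{in}(u))=0\ \forall s\in\mathcal S,u\in D(s)\}$; $\mathcal C_S(\mathsf P)=\{h:h(\mathcal A_r\wedge\mathcal B_r)=0\ \forall r\in\mathcal R\}$. A stochastic network code is a family of discrete random variables $\{Y_f:f\in\mathcal S\cup\mathcal E\cup\mathcal V\}$ with finite supports ($Y_u$, $u\in\mathcal V$, is a local random key at node $u$) such that each $Y_s$ is uniform on its alphabet and its entropy function $\alpha\mapsto H(Y_f,f\in\alpha)$ lies in $\mathcal C_I(\mathsf P)\cap\mathcal C_T(\mathsf P)$. It is $q$-linear if each $Y_f$, $f\in\mathcal S\cup\mathcal V$, is a row vector over $GF(q)$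 with entries independent and uniform over $GF(q)$, and for every $e\in\mathcal E$, $Y_e=\phi_e(Y_{\mathrm{in}(e)},Y_{\mathrm{tail}(e)})$ for a $GF(q)$-linear map $\phi_e$. $\mathrm{SP}(X)$ is the support of $X$. A rate-capacity tuple $(\lambda,\omega)$, $\lambda:\mathcal S\to\mathbb R_{\ge0}$, $\omega:\mathcal E\to\mathbb R_{\ge0}$, is $0$-achievable subject to $q$-linearity and strong secrecy if there exist $q$-linear stochastic network codes $\{Y^n_f\}$ and $c_n>0$ with (S1) $\lim_nc_n\log|\mathrm{SP}(Y^n_e)|\le\omega(e)$ and $\lim_nc_n\log|\mathrm{SP}(Y^n_s)|\ge\lambda(s)$ for all $e,s$; (S2) $H(Y^n_s\mid Y^n_f,f\in\mathrm{in}(u))=0$ for all $n$, $s$, $u\in D(s)$; (S3$'$) $I(Y^n_{\mathcal A_r};Y^n_{\mathcal B_r})=0$ for all $n$ and $r\in\mathcal R$. A function $h\in\mathcal H[\mathcal N]$ is $q$-representable if there are subspaces $\mathbb U_i$ ($i\in\mathcal N$) of a finite-dimensional $GF(q)$-vector space with $h(\alpha)=\dim\langle\mathbb U_i:i\in\alpha\rangle$; weakly $q$-representable if $ch$ is $q$-representable for some $c>0$; almost $q$-representable if a limit of weakly $q$-representable functions. $\bar\Upsilon^*_q$ is the set of almost $q$-representable functions in $\mathcal H[\mathcal S\cup\mathcal E\cup\mathcal V]$. $\mathrm{proj}_{\mathsf P}[h]=(h(s),s\in\mathcal S;h(e),e\in\mathcal E)$, applied elementwise to sets. For a set $\mathcal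 R'$ of tuples, $\mathsf{CL}(\mathcal R')$ is the set of $(\lambda,\omega)$ such that there exist $(\lambda^n,\omega^n)\in\mathcal R'$ and $c_n>0$ with $\lim_nc_n\omega^n(e)\le\omega(e)$ and $\lim_nc_n\lambda^n(s)\ge\lambda(s)$ for all $e,s$. *)

(* Defs.v *)
From HB Require Import structures.
From mathcomp Require Import all_boot all_order all_algebra.
From mathcomp Require Import all_classical all_reals all_analysis.
Unset Printing Implicit Defensive.
Import Order.TTheory GRing.Theory Num.Theory.
Import numFieldNormedType.Exports.
Local Open Scope ring_scope.

Record problem := Problem {
  Src : finType;
  Edg : finType;
  Nod : finType;
  Adv : finType;
  tail : Edg -> Nod;
  head : Edg -> {set Nod};
  O : Src -> {set Nod};           (* where source s is available *)
  D : Src -> {set Nod};           (* sinks of source s *)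
  WA : Adv -> {set Src};          (* A_r : targeted sources *)
  WB : Adv -> {set Edg}           (* B_r : observed links *)
}.
Arguments tail {p} _.
Arguments head {p} _.
Arguments O {p} _.
Arguments D {p} _.
Arguments WA {p} _.
Arguments WB {p} _.

Section Problem.
Variable P : problem.

Definition adj : rel (Nod P) :=
  fun u v => [exists e, (tail e == u) && (v \in head e)].
Definition acyclic : Prop :=
  forall (e : Edg P) (v : Nod P), v \in head e -> ~~ connect adj v (tail e).

Definition idx : finType := (Src P + Edg P + Nod P)%type.
Definition isrc (s : Src P) : idx := inl (inl s).
Definition iedge (e : Edg P) : idx := inl (inr e).
Definition inode (u : Nod P) : idx := inr u.

(* heads of sources (imaginary edges, head(s) = O(s)) and edges *)
Definition head_of (i : idx) : {set Nod P} :=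
  match i with
  | inl (inl s) => O s
  | inl (inr e) => head e
  | inr _ => finset.set0
  end.
Definition in_e (e : Edg P) : {set idx} := [set i | tail e \in head_of i].
Definition in_u (u : Nod P) : {set idx} := [set i | u \in head_of i].
Definition SV : {set idx} :=
  [set i | match i with inl (inr _) => false | _ => true end].
Definition srcs (A : {set Src P}) : {set idx} := [set isrc s | s in A].
Definition edges (B : {set Edg P}) : {set idx} := [set iedge e | e in B].

Section SetFunctions.
Variable R : realType.
Implicit Types (g h : {set idx} -> R).

Definition cond g (a b : {set idx}) : R := g (a :|: b) - g b.
Definition meet g (a b : {set idx}) : R := g a + g b - g (a :|: b).

Definition C_I h : Prop :=
  h SV = \sum_(s : Src P) h [set isrc s] + \sum_(u : Nod P) h [set inode u].
Definition C_T h : Prop :=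
  forall e : Edg P, cond h [set iedge e] (in_e e :|: [set inode (tail e)]) = 0.
Definition C_D h : Prop :=
  forall (s : Src P) (u : Nod P), u \in D s -> cond h [set isrc s] (in_u u) = 0.
Definition C_S h : Prop :=
  forall r : Adv P, meet h (srcs (WA r)) (edges (WB r)) = 0.

Definition q_rep (F : finFieldType) h : Prop :=
  exists (n : nat) (U : idx -> {vspace 'rV[F]_n}),
    forall a : {set idx}, h a = (\dim (\sum_(i in a) U i)%VS)%:R.
Definition weak_q_rep (F : finFieldType) h : Prop :=
  exists c : R, 0 < c /\ q_rep F (fun a => c * h a).
Definition almost_q_rep (F : finFieldType) h : Prop :=
  exists hs : nat -> {set idx} -> R,
    (forall n, weak_q_rep F (hs n)) /\
    (forall a : {set idx}, ((fun n => hs n a) @ \oo --> h a)%classic).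

Definition lim_le (u : nat -> R) (x : R) : Prop :=
  exists l : R, (u @ \oo --> l)%classic /\ l <= x.
Definition lim_ge (u : nat -> R) (x : R) : Prop :=
  exists l : R, (u @ \oo --> l)%classic /\ x <= l.

Definition tuple := ((Src P -> R) * (Edg P -> R))%type.

Definition proj_set (Hs : ({set idx} -> R) -> Prop) : tuple -> Prop :=
  fun t => exists h, Hs h /\ (forall s, t.1 s = h [set isrc s])
                         /\ (forall e, t.2 e = h [set iedge e]).

Definition CL (Rs : tuple -> Prop) : tuple -> Prop :=
  fun t => exists (tn : nat -> tuple) (c : nat -> R),
    (forall n, Rs (tn n)) /\ (forall n, 0 < c n) /\
    (forall e, lim_le (fun n => c n * (tn n).2 e) (t.2 e)) /\
    (forall s, lim_ge (fun n => c n * (tn n).1 s) (t.1 s)).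

(* The random variables Y_f are defined on a finite probability space (Om, pr);
   each Y_f is a row vector over F of length dm f.  phi e i is the block of the
   GF(q)-linear map phi_e acting on the input Y_i, i in in(e) ∪ {tail(e)}. *)
Record qcode (F : finFieldType) := QCode {
  Om : finType;
  pr : Om -> R;
  dm : idx -> nat;
  Y : forall i : idx, Om -> 'rV[F]_(dm i);
  phi : forall (e : Edg P) (i : idx), 'M[F]_(dm i, dm (iedge e))
}.
Arguments Om {F} q.
Arguments pr {F} q _.
Arguments dm {F} q _.
Arguments Y {F} q i _.
Arguments phi {F} q e i.

Variable F : finFieldType.
Implicit Type c : qcode F.

Definition agree c (a : {set idx}) (w w' : Om c) : bool :=
  [forall i in a, Y c i w == Y c i w'].
Definition prob_agree c (a : {set idx}) (w : Om c) : R :=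
  \sum_(w' | agree c a w w') pr c w'.
Definition entropy c (a : {set idx}) : R :=
  \sum_(w : Om c) pr c w * (- ln (prob_agree c a w)).

Definition SP c (i : idx) : {set 'rV[F]_(dm c i)} :=
  [set Y c i w | w in [set w | 0 < pr c w]].

Definition is_qlin_code c : Prop :=
  (forall w, 0 <= pr c w) /\ \sum_(w : Om c) pr c w = 1 /\
  (* Y_f, f in S ∪ V, is a vector of i.i.d. uniform entries over F,
     i.e. uniform on its alphabet F^(dm f) *)
  (forall i, i \in SV -> forall y : 'rV[F]_(dm c i),
      \sum_(w | Y c i w == y) pr c w = ((#|F| ^ dm c i)%:R)^-1) /\
  (forall (e : Edg P) (w : Om c),
      Y c (iedge e) w =
      \sum_(i in in_e e :|: [set inode (tail e)]) Y c i w *m phi c e i) /\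
  C_I (entropy c) /\ C_T (entropy c).

Definition achievable_qlin_strong (t : tuple) : Prop :=
  exists (cs : nat -> qcode F) (cn : nat -> R),
    (forall n, is_qlin_code (cs n)) /\ (forall n, 0 < cn n) /\
    (forall e, lim_le (fun n => cn n * ln (#|SP (cs n) (iedge e)|%:R)) (t.2 e)) /\
    (forall s, lim_ge (fun n => cn n * ln (#|SP (cs n) (isrc s)|%:R)) (t.1 s)) /\
    (forall n s u, u \in D s -> cond (entropy (cs n)) [set isrc s] (in_u u) = 0) /\
    (forall n r, meet (entropy (cs n)) (srcs (WA r)) (edges (WB r)) = 0).

End SetFunctions.
End Problem.

(* Main.v *)
Require Import Defs.
From HB Require Import structures.
From mathcomp Require Import all_boot all_order all_algebra.
From mathcomp Require Import all_classical all_reals all_analysis.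
From mathcomp Require Import zify ring lra.
From mathcomp Require mxabelem.
Import Order.TTheory GRing.Theory Num.Theory.
Import numFieldNormedType.Exports.
Local Open Scope ring_scope.

(* For a q-linear code the equality C_I forces the word formed by the sources and
   keys to be uniform on F^N (equality in the maximum-entropy bound); acyclicity
   makes every Y_f a linear image of it, so the entropy function is a rank
   function times ln q.

   Conversely, take subspaces U_f whose rank function nearly satisfies the four
   constraints, with defect d.  Shrinking the U_f, at the cost of O(d) dimensions
   each, makes the sources and keys independent and every edge a function of its
   inputs.  By acyclicity the edges entering u are independent of the sources
   located at u, so each source is nearly contained in the span of the edges
   entering each of its other sinks.  Intersecting a source with these spans and
   removing the components of the leaked spaces gives exact decoding and secrecy.
   The part of the source lost in this way is still needed by the edges leaving
   its node: as |O(s)| = 1, it can be moved into the key of that node. *)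

(** * Dimension lost when the subspaces in sums and intersections are shrunk *)

Section SubspaceLoss.
Variables (F : fieldType) (vT : vectType F).
Implicit Types A B U V W X Y Z : {vspace vT}.

Lemma dimv_diff_sub A B : (B <= A)%VS -> (\dim A = \dim B + \dim (A :\: B))%N.
Proof. by move=> /capv_idPr sBA; rewrite -(dimv_cap_compl A B) sBA. Qed.

Lemma addv_diff_sub A B : (B <= A)%VS -> (B + (A :\: B))%VS = A.
Proof. by move=> /capv_idPr sBA; rewrite addvC -[RHS](addv_diff_cap A B) sBA. Qed.

Lemma dimv_add_le U V : (\dim (U + V) <= \dim U + \dim V)%N.
Proof. by rewrite -dimv_sum_cap leq_addr. Qed.

Lemma dimv_sum_le (I : Type) (r : seq I) (a : pred I) (U : I -> {vspace vT}) :
  (\dim (\sum_(i <- r | a i) U i)%VS <= \sum_(i <- r | a i) \dim (U i))%N.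
Proof.
elim: r => [|i r IH]; first by rewrite !big_nil dimv0.
rewrite !big_cons; case: (a i) => //.
exact: leq_trans (dimv_add_le _ _) (leq_add _ _).
Qed.

(** [A + B] is spanned by [A' + B'] together with a complement of [A'] in [A] and one of [B'] in
    [B], of dimensions at most [k] and [l]. *)
Lemma addv_loss A A' B B' k l : (A' <= A)%VS -> (B' <= B)%VS ->
  (\dim A <= \dim A' + k)%N -> (\dim B <= \dim B' + l)%N ->
  (\dim (A + B) <= \dim (A' + B') + (k + l))%N.
Proof.
move=> sA sB; rewrite (dimv_diff_sub _ _ sA) (dimv_diff_sub _ _ sB) !leq_add2l.
move=> hk hl; rewrite -{1}(addv_diff_sub _ _ sA) -{1}(addv_diff_sub _ _ sB).
rewrite -addvA [(_ + (B' + _))%VS]addvA [(_ + B')%VS]addvC -addvA addvA.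
apply: leq_trans (dimv_add_le _ _) _; rewrite leq_add2l.
exact: leq_trans (dimv_add_le _ _) (leq_add _ _).
Qed.

Lemma sumv_loss (I : Type) (r : seq I) (a : pred I) (U W : I -> {vspace vT})
    (k : I -> nat) :
  (forall i, a i -> (W i <= U i)%VS) ->
  (forall i, a i -> (\dim (U i) <= \dim (W i) + k i)%N) ->
  (\dim (\sum_(i <- r | a i) U i)%VS
     <= \dim (\sum_(i <- r | a i) W i)%VS + \sum_(i <- r | a i) k i)%N.
Proof.
move=> sW hk; elim: r => [|i r IH]; first by rewrite !big_nil dimv0.
rewrite !big_cons; case ai: (a i) => //.
apply: addv_loss => //; [exact: sW | | exact: hk].
elim: r {IH} => [|j r IH]; first by rewrite !big_nil sub0v.
by rewrite !big_cons; case aj: (a j) => //; apply: addvS => //; apply: sW.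
Qed.

(** The loss is [\dim U - \dim (U :&: Z') = \dim (U + Z') - \dim Z']; enlarging [Z'] to [Z] in the
    sum only increases it. *)
Lemma capv_loss U Z Z' d k : (Z' <= Z)%VS ->
  (\dim (U + Z) <= \dim Z + d)%N -> (\dim Z <= \dim Z' + k)%N ->
  (\dim U <= \dim (U :&: Z') + (d + k))%N.
Proof.
move=> sZ hd hk; have := dimv_sum_cap U Z'.
have /dimvS h : (U + Z' <= U + Z)%VS by apply: addvS.
lia.
Qed.

(** Codimensions inside [W] add up under intersection. The factor [size r] also counts the indices
    rejected by [a], which is harmless for an upper bound. *)
Lemma bigcapv_loss (I : Type) (r : seq I) (a : pred I) (E : I -> {vspace vT}) W d :
  (forall i, a i -> (\dim W <= \dim (W :&: E i) + d)%N) ->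
  (\dim W <= \dim (W :&: \bigcap_(i <- r | a i) E i)%VS + size r * d)%N.
Proof.
move=> hE; elim: r => [|i r IH]; first by rewrite big_nil capvf addn0.
rewrite big_cons /=; case ai: (a i); last first.
  by apply: leq_trans IH _; rewrite leq_add2l leq_mul2r leqnSn orbT.
set C := (\bigcap_(j <- r | a j) E j)%VS in IH *.
have := dimv_sum_cap (W :&: E i) (W :&: C).
have -> : ((W :&: E i) :&: (W :&: C) = W :&: (E i :&: C))%VS.
  by rewrite capvA [((W :&: E i) :&: W)%VS]capvC [(W :&: (W :&: E i))%VS]capvA capvv -capvA.
have /dimvS hs : ((W :&: E i) + (W :&: C) <= W)%VS by rewrite subv_add !capvSl.
move: (hE i ai) IH hs; rewrite mulSn.
move: (\dim W) (\dim (W :&: E i)) (\dim (W :&: C)) (\dim (_ + _)%VS) (\dim _).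
move=> w x y s z h1 h2 h3 h4.
lia.
Qed.

(** Directness of the sum, stated through dimensions so that it is [C_I] read on the rank
    function. *)
Definition independent (I : finType) (W : I -> {vspace vT}) (A : {set I}) :=
  \dim (\sum_(i in A) W i)%VS = (\sum_(i in A) \dim (W i))%N.

Lemma sumv_setU (I : finType) (W : I -> {vspace vT}) (A B : {set I}) :
  (\sum_(i in A :|: B) W i = \sum_(i in A) W i + \sum_(i in B) W i)%VS.
Proof. by apply: big_setU => V; apply: addvv. Qed.

Lemma independentS (I : finType) (W : I -> {vspace vT}) (A B : {set I}) :
  B \subset A -> independent I W A -> independent I W B.
Proof.
move=> sBA; rewrite /independent => dA; apply/eqP; rewrite eqn_leq dimv_sum_le /=.
have eA : A = B :|: (A :\: B) by rewrite -{1}(finset.setIidPr sBA) finset.setID.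
have hs : (\sum_(i in A) \dim (W i)
    = \sum_(i in B) \dim (W i) + \sum_(i in A :\: B) \dim (W i))%N.
  by rewrite (big_setID B) (finset.setIidPr sBA).
move: dA; rewrite hs {1}eA sumv_setU => dA.
rewrite -(leq_add2r (\sum_(i in A :\: B) \dim (W i))) -dA.
apply: leq_trans (dimv_add_le _ _) _.
by rewrite leq_add2l dimv_sum_le.
Qed.

Lemma independent_disjoint (I : finType) (W : I -> {vspace vT}) (A B C : {set I}) X Y :
  independent I W A -> B \subset A -> C \subset A -> [disjoint B & C] ->
  (X <= \sum_(i in B) W i)%VS -> (Y <= \sum_(i in C) W i)%VS ->
  (X :&: Y)%VS = 0%VS.
Proof.
move=> iA sB sC dBC sX sY.
have iU : independent I W (B :|: C) by apply: independentS iA; rewrite finset.subUset sB.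
have := dimv_sum_cap (\sum_(i in B) W i)%VS (\sum_(i in C) W i)%VS.
rewrite -sumv_setU iU (independentS _ _ _ _ sB iA) (independentS _ _ _ _ sC iA).
rewrite (eq_bigl [predU B & C]) => [|i]; last by rewrite !inE.
rewrite bigU //= => e.
have /eqP : \dim (\sum_(i in B) W i :&: \sum_(i in C) W i)%VS = 0%N by move: e; lia.
rewrite dimv_eq0 => /eqP e0; apply/eqP; rewrite -subv0 -e0.
exact: capvS.
Qed.

(** Greedy choice along an enumeration: each [U i] is replaced by the part of it complementary to
    the span of the spaces after it, which leaves the total span unchanged. *)
Lemma independent_sub_exists (I : finType) (U : I -> {vspace vT}) (A : {set I}) :
  exists W : I -> {vspace vT},
    [/\ forall i, (W i <= U i)%VS,
        (\sum_(i in A) W i = \sum_(i in A) U i)%VS & independent I W A].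
Proof.
suff [W [sW eW iW]] : exists W : I -> {vspace vT},
    [/\ forall i, (W i <= U i)%VS,
        (\sum_(i <- enum A) W i = \sum_(i <- enum A) U i)%VS &
        \dim (\sum_(i <- enum A) W i)%VS = (\sum_(i <- enum A) \dim (W i))%N].
  by exists W; split=> //; move: eW iW; rewrite /independent !big_enum.
elim: (enum A) (enum_uniq A) => [_|i r IH /= /andP[ir /IH[W [sW eW iW]]]].
  by exists (fun _ => 0%VS); split=> [i||]; rewrite ?sub0v // !big_nil ?dimv0.
pose S := (\sum_(j <- r) U j)%VS.
pose W' j := if j == i then (U i :\: S)%VS else W j.
have W'r j : j \in r -> W' j = W j.
  by rewrite /W'; case: eqP => // -> ; rewrite (negPf ir).
have e1 : (\sum_(j <- r) W' j = \sum_(j <- r) W j)%VS.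
  by rewrite big_seq [RHS]big_seq; apply: eq_bigr => j /W'r.
have e2 : (\sum_(j <- r) \dim (W' j) = \sum_(j <- r) \dim (W j))%N.
  by rewrite big_seq [RHS]big_seq; apply: eq_bigr => j /W'r ->.
have W'i : W' i = (U i :\: S)%VS by rewrite /W' eqxx.
have aS : ((U i :\: S) + S = U i + S)%VS.
  apply: subv_anti; rewrite subv_add addvSr (subv_trans (diffvSl _ _)) ?addvSl //=.
  rewrite subv_add addvSr andbT -{1}(addv_diff_cap (U i) S).
  by apply: addvS => //; apply: capvSr.
exists W'; split.
- by move=> j; rewrite /W'; case: eqP => // ->; apply: diffvSl.
- by rewrite !big_cons e1 eW W'i.
- rewrite !big_cons e1 e2 eW -iW eW W'i.
  by have := dimv_sum_cap (U i :\: S) S; rewrite capv_diff dimv0 addn0.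
Qed.

End SubspaceLoss.

(** * Induction along an acyclic network *)

Section Network.
Variable P : problem.
Hypothesis hacyc : acyclic P.
Hypothesis hO : forall s : Src P, #|O s| = 1%N.

(** Counts the nodes that reach [v], including [v] itself. By acyclicity it grows strictly along
    every edge, which makes it a measure for induction. *)
Definition depth (v : Nod P) : nat := #|[set u | connect (adj P) u v]|.

Lemma depth_head (e : Edg P) (v : Nod P) : v \in Defs.head e -> (depth (tail e) < depth v)%N.
Proof.
move=> ve; apply: proper_card; apply/properP; split; last first.
  by exists v; rewrite inE ?connect0 //; apply: hacyc.
apply/fintype.subsetP => u; rewrite !inE => /connect_trans; apply.
by apply: connect1; apply/existsP; exists e; rewrite eqxx.
Qed.

Lemma edge_ind (Q : Edg P -> Prop) :
  (forall e, (forall f, tail e \in Defs.head f -> Q f) -> Q e) -> forall e, Q e.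
Proof.
move=> IH e; have [n] := ubnP (depth (tail e)); elim: n e => // n IHn e he.
apply: IH => f /depth_head hf; apply: IHn; exact: leq_trans hf _.
Qed.

Definition inputs (e : Edg P) : {set idx P} := in_e P e :|: [set inode P (tail e)].

(** * Making every edge a function of its inputs *)

Section Refine.
Variables (F : fieldType) (vT : vectType F) (U V : idx P -> {vspace vT}) (d : nat).
Hypothesis VU : forall i, (V i <= U i)%VS.
Hypothesis VU_loss : forall i, (\dim (U i) <= \dim (V i) + d)%N.
Hypothesis U_edge : forall e, (\dim (U (iedge P e) + \sum_(i in inputs e) U i)
  <= \dim (\sum_(i in inputs e) U i)%VS + d)%N.

(** The intersection is with the original [U], not with the current space of the edge, so the new
    space depends on the current spaces of the inputs alone. This is what makes the iteration settle
    in order of depth. *)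
Definition refine (W : idx P -> {vspace vT}) (i : idx P) : {vspace vT} :=
  match i with
  | inl (inr e) => (U (iedge P e) :&: \sum_(j in inputs e) W j)%VS
  | _ => W i
  end.

Lemma iter_refine_SV k i : i \in SV P -> iter k refine V i = V i.
Proof. by rewrite inE; elim: k => //= k IH; move: i IH => [[]|]. Qed.

Lemma iter_refine_sub k i : (iter k refine V i <= U i)%VS.
Proof.
elim: k i => [|k IH] i; first exact: VU.
by rewrite iterS; case: i => [[s|e]|u] /=; [apply: IH | apply: capvSl | apply: IH].
Qed.

(** One round turns a loss [L] into at most [d + #|idx P| * L]: an edge pays its own defect and the
    losses of its inputs. As [d <= L], the factor per round is at most [#|idx P|.+1]. *)
Lemma iter_refine_loss k i :
  (\dim (U i) <= \dim (iter k refine V i) + #|idx P|.+1 ^ k * d)%N.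
Proof.
elim: k i => [|k IH] i; first by rewrite expn0 mul1n.
set L := (_ ^ k * d)%N in IH.
have hL : (d <= L)%N by rewrite leq_pmull // expn_gt0.
have -> : (#|idx P|.+1 ^ k.+1 * d = L + #|idx P| * L)%N by rewrite expnS -mulnA mulSn.
have hsv : (\dim (U i) <= \dim (iter k refine V i) + (L + #|idx P| * L))%N.
  by apply: leq_trans (IH i) _; rewrite leq_add2l leq_addr.
rewrite iterS; case: i hsv => [[s|e]|u] //= _.
have sW : (\sum_(j in inputs e) iter k refine V j <= \sum_(j in inputs e) U j)%VS.
  by apply/subv_sumP => j hj; apply: (sumv_sup j) => //; apply: iter_refine_sub.
have hl := sumv_loss _ _ _ (index_enum (idx P)) (mem (inputs e)) _ _ (fun=> L)
  (fun i _ => iter_refine_sub k i) (fun i _ => IH i).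
apply: leq_trans (capv_loss _ _ _ _ _ _ _ sW (U_edge e) hl) _.
rewrite leq_add2l leq_add // sum_nat_const leq_mul2r max_card orbT //.
Qed.

(** The edges entering the tail of [e] start at smaller depth, so they are settled one round
    earlier. The base case is void, because a depth is at least 1. *)
Lemma iter_refine_stable k e : (depth (tail e) <= k)%N ->
  iter k.+1 refine V (iedge P e) = iter k refine V (iedge P e).
Proof.
elim: k e => [|k IH] e he.
  move: he; rewrite leqn0 cards_eq0 => /eqP/setP/(_ (tail e)).
  by rewrite !inE connect0.
rewrite iterS [in RHS]iterS /=; congr (_ :&: _)%VS; apply: eq_bigr => i.
rewrite !inE; case: i => [[s|f]|u] //= /orP[hf|/eqP//].
by apply: IH; rewrite -ltnS; apply: leq_trans he; apply: depth_head.
Qed.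

Lemma refine_exists : exists W : idx P -> {vspace vT},
  [/\ forall i, i \in SV P -> W i = V i, forall i, (W i <= U i)%VS,
      forall e, (W (iedge P e) <= \sum_(i in inputs e) W i)%VS
    & forall i, (\dim (U i) <= \dim (W i) + #|idx P|.+1 ^ #|Nod P| * d)%N].
Proof.
(* No depth exceeds the number of nodes, so after this many rounds all edges are fixed by
   [refine]. *)
exists (iter #|Nod P| refine V); split.
- exact: iter_refine_SV.
- exact: iter_refine_sub.
- by move=> e; rewrite -iter_refine_stable ?max_card //= capvSr.
- exact: iter_refine_loss.
Qed.

End Refine.

(** * Exact decoding and secrecy by shrinking the sources *)

(** Restricted to sources and keys, the indices on which independence is available; it is disjoint
    from the sources located at [u]. *)
Definition away (u : Nod P) : {set idx P} :=
  [set i | match i with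
           | inl (inl s) => u \notin O s
           | inl (inr _) => false
           | inr v => v != u
           end].

Definition in_srcs (u : Nod P) : {set idx P} := srcs P [set s | u \in O s].
Definition in_edges (u : Nod P) : {set idx P} := edges P [set e | u \in Defs.head e].

Lemma mem_srcs A s : (isrc P s \in srcs P A) = (s \in A).
Proof. by apply: mem_imset => x y []. Qed.

Lemma mem_edges A e : (iedge P e \in edges P A) = (e \in A).
Proof. by apply: mem_imset => x y []. Qed.

Lemma in_uE u : in_u P u = in_srcs u :|: in_edges u.
Proof.
apply/setP => -[[s|e]|v]; rewrite !inE /=.
- rewrite mem_srcs inE orb_idr // => /imsetP[x _]; discriminate.
- rewrite mem_edges inE orb_idl // => /imsetP[x _]; discriminate.
- by apply/esym/negbTE/negP => /orP[] /imsetP[x _].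
Qed.

Lemma O_unique (s : Src P) u v : u \in O s -> v \in O s -> u = v.
Proof. by move/eqP: (hO s) => /cards1P[w ->]; rewrite !inE => /eqP-> /eqP->. Qed.

Section Adjust.
Variables (F : fieldType) (vT : vectType F) (W : idx P -> {vspace vT}) (d : nat).
Hypothesis W_indep : independent F vT (idx P) W (SV P).
Hypothesis W_edge : forall e, (W (iedge P e) <= \sum_(i in inputs e) W i)%VS.
Hypothesis W_sink : forall s u, u \in D s ->
  (\dim (W (isrc P s) + \sum_(i in in_u P u) W i)
     <= \dim (\sum_(i in in_u P u) W i)%VS + d)%N.
Hypothesis W_leak : forall r, (\dim (\sum_(i in srcs P (WA r)) W i
  :&: \sum_(i in edges P (WB r)) W i) <= d)%N.

(** Induction along the inputs. Since [u] does not reach the tail of [e], that tail is another node;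
    its key is not the key of [u], and a source available there has no second location at [u]. *)
Lemma edge_away u e : ~~ connect (adj P) u (tail e) ->
  (W (iedge P e) <= \sum_(i in away u) W i)%VS.
Proof.
elim/edge_ind: e => e IH hue; apply: subv_trans (W_edge e) _.
have hne : tail e != u by apply: contraNneq hue => ->; apply: connect0.
apply/subv_sumP => -[[s|f]|v]; rewrite !inE /= ?orbF.
- move=> hs; apply: (sumv_sup (isrc P s)) => //; rewrite inE /=.
  by apply: contra hne => /(O_unique _ _ _ hs) ->.
- move=> hf; apply: IH => //; apply: contra hue => /connect_trans; apply.
  by apply: connect1; apply/existsP; exists f; rewrite eqxx.
- by move=> /eqP[->]; apply: (sumv_sup (inode P (tail e))) => //; rewrite inE.
Qed.

Definition edge_space (u : Nod P) : {vspace vT} := (\sum_(i in in_edges u) W i)%VS.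

(* Edges entering [u] carry nothing about the sources located at [u], so those
   sources are of no help in decoding [s] at [u]. *)
Lemma sink_edge_space s u : u \in D s -> u \notin O s ->
  (\dim (W (isrc P s)) <= \dim (W (isrc P s) :&: edge_space u) + d)%N.
Proof.
move=> /W_sink + hu; rewrite in_uE sumv_setU -/(edge_space u).
set S := (\sum_(i in in_srcs u) W i)%VS; set E := edge_space u; set X := W _ => hd.
have dj : [disjoint away u & in_srcs u].
  rewrite disjoint_sym finset.disjoints_subset; apply/fintype.subsetP => i /imsetP[s' + ->].
  by rewrite !inE /= negbK.
have sA : away u \subset SV P by apply/fintype.subsetP => -[[]|] x; rewrite !inE.
have sS : in_srcs u \subset SV P.
  by apply/fintype.subsetP => i /imsetP[s' _ ->]; rewrite !inE.
have hE : (E <= \sum_(i in away u) W i)%VS.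
  apply/subv_sumP => i /imsetP[e + ->]; rewrite inE => he.
  by apply: edge_away; apply: hacyc.
have hX : (X <= \sum_(i in away u) W i)%VS by apply: (sumv_sup (isrc P s)); rewrite ?inE.
have hXE : (X + E <= \sum_(i in away u) W i)%VS by rewrite subv_add hX.
(* Both [E] and [X + E] lie in the span of [away u], which meets [S] trivially. Hence [\dim S]
   cancels from [hd], leaving a comparison of [X + E] with [E]. *)
have c1 := independent_disjoint _ _ _ _ _ _ _ _ _ W_indep sA sS dj hE (subvv S).
have c2 := independent_disjoint _ _ _ _ _ _ _ _ _ W_indep sA sS dj hXE (subvv S).
have e1 := dimv_sum_cap E S; have e2 := dimv_sum_cap (X + E) S.
move: hd; rewrite [(S + E)%VS]addvC addvA.
have := dimv_sum_cap X E; rewrite c1 dimv0 in e1; rewrite c2 dimv0 in e2.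
lia.
Qed.

(** Only sinks away from [s] impose an intersection; at a sink where [s] is available, [s] is itself
    one of the inputs. *)
Definition decodable (s : Src P) : {vspace vT} :=
  (W (isrc P s) :&: \bigcap_(u | (u \in D s) && (u \notin O s)) edge_space u)%VS.

Lemma decodable_loss s :
  (\dim (W (isrc P s)) <= \dim (decodable s) + #|Nod P| * d)%N.
Proof.
have -> : #|Nod P| = size (index_enum (Nod P)) by rewrite cardT enumT.
by apply: bigcapv_loss => u /andP[uD uO]; apply: sink_edge_space.
Qed.

(** Its dimension is the mutual information [meet] evaluated on the rank function. *)
Definition leak (r : Adv P) : {vspace vT} :=
  (\sum_(i in srcs P (WA r)) W i :&: \sum_(i in edges P (WB r)) W i)%VS.

(* The component along source [s] of the space leaked to adversary [r]. *)
Definition leak_src (r : Adv P) (s : Src P) : {vspace vT} :=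
  (W (isrc P s) :&: (leak r + \sum_(i in srcs P (WA r) :\ isrc P s) W i))%VS.

(** By independence [leak_src r s] meets the span [Q] of the other targeted sources trivially, and
    it lies in [leak r + Q]; modulo [Q] it therefore injects into the image of [leak r]. *)
Lemma dim_leak_src r s : (\dim (leak_src r s) <= d)%N.
Proof.
set Q := (\sum_(i in srcs P (WA r) :\ isrc P s) W i)%VS.
have sW : (leak_src r s <= \sum_(i in [set isrc P s]) W i)%VS.
  by rewrite big_set1 capvSl.
have s1 : [set isrc P s] \subset SV P.
  by apply/fintype.subsetP => i; rewrite !inE => /eqP->.
have s2 : srcs P (WA r) :\ isrc P s \subset SV P.
  by apply/fintype.subsetP => i; rewrite !inE => /andP[_ /imsetP[x _ ->]].
have dj : [disjoint [set isrc P s] & srcs P (WA r) :\ isrc P s].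
  by rewrite disjoints1 !inE eqxx.
have c0 := independent_disjoint _ _ _ _ _ _ _ _ _ W_indep s1 s2 dj sW (subvv Q).
have := dimv_sum_cap (leak_src r s) Q; rewrite c0 dimv0.
have /dimvS : (leak_src r s + Q <= leak r + Q)%VS.
  by rewrite subv_add capvSr addvSr.
by have := dimv_add_le _ _ (leak r) Q; have := W_leak r; rewrite -/(leak r); lia.
Qed.

Definition secure (s : Src P) : {vspace vT} :=
  (decodable s :\: \sum_r leak_src r s)%VS.

Lemma secure_sub s : (secure s <= W (isrc P s))%VS.
Proof. exact: subv_trans (diffvSl _ _) (capvSl _ _). Qed.

(** Each sink costs at most [d] through [decodable], and each adversary at most [d] through
    [leak_src]. *)
Lemma secure_loss s :
  (\dim (W (isrc P s)) <= \dim (secure s) + (#|Nod P| + #|Adv P|) * d)%N.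
Proof.
have := decodable_loss s; have := dimv_cap_compl (decodable s) (\sum_r leak_src r s).
rewrite -/(secure s).
have /dimvS : (decodable s :&: \sum_r leak_src r s <= \sum_r leak_src r s)%VS.
  exact: capvSr.
have := dimv_sum_le _ _ _ (index_enum (Adv P)) xpredT (leak_src^~ s).
have : (\sum_r \dim (leak_src r s) <= #|Adv P| * d)%N.
  rewrite -sum_nat_const; apply: leq_sum => r _; exact: dim_leak_src.
rewrite mulnDl; lia.
Qed.

(* What a source gives up becomes part of the key of the node holding it. *)
Definition adjust (i : idx P) : {vspace vT} :=
  match i with
  | inl (inl s) => secure s
  | inl (inr e) => W i
  | inr u => (W i + \sum_(s | u \in O s) (W (isrc P s) :\: secure s))%VS
  end.

Lemma big_SV (T : Type) (x : T) (op : Monoid.com_law x) (f : idx P -> T) :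
  \big[op/x]_(i in SV P) f i
  = op (\big[op/x]_s f (isrc P s)) (\big[op/x]_u f (inode P u)).
Proof.
rewrite big_mkcond !big_sumType /=.
rewrite [X in op (op _ X) _]big1 ?Monoid.mulm1; last by move=> e _; rewrite inE.
by congr (op _ _); apply: eq_bigr => i _; rewrite inE.
Qed.

Lemma adjust_src_sub s u : u \in O s ->
  (W (isrc P s) <= adjust (isrc P s) + adjust (inode P u))%VS.
Proof.
move=> uO; rewrite -(addv_diff_sub _ _ _ _ (secure_sub s)) /=; apply: addvS => //.
by apply: subv_trans (addvSr _ _); apply: (sumv_sup s).
Qed.

(** The adjusted spaces still span the old sources and keys, while their total dimension does not
    exceed the old total. So the dimension of the span reaches the total. *)
Lemma adjust_independent : independent F vT (idx P) adjust (SV P).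
Proof.
apply/eqP; rewrite eqn_leq dimv_sum_le /=.
have sW : (\sum_(i in SV P) W i <= \sum_(i in SV P) adjust i)%VS.
  apply/subv_sumP => -[[s|e]|u] hi; last 1 first.
  - by apply: (sumv_sup (inode P u)) => //=; apply: addvSl.
  - have [u uO] : exists u, u \in O s.
      by apply/card_gt0P; rewrite hO.
    apply: subv_trans (adjust_src_sub s u uO) _; rewrite subv_add.
    by apply/andP; split; [apply: (sumv_sup (isrc P s)) | apply: (sumv_sup (inode P u))];
      rewrite ?inE.
  - by rewrite inE in hi.
apply: leq_trans (dimvS sW); rewrite W_indep !big_SV /=.
have hK u : (\dim (adjust (inode P u)) <= \dim (W (inode P u))
    + \sum_(s | u \in O s) \dim (W (isrc P s) :\: secure s)%VS)%N.
  by apply: leq_trans (dimv_add_le _ _ _ _) _; rewrite leq_add2l dimv_sum_le.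
apply: (@leq_trans (\sum_s \dim (secure s) + \sum_u (\dim (W (inode P u))
    + \sum_(s | u \in O s) \dim (W (isrc P s) :\: secure s)%VS))%N).
  by rewrite leq_add2l; apply: leq_sum => u _; apply: hK.
(* Summed over nodes, the complement taken from a source is counted [#|O s| = 1] times, exactly
   compensating what that source lost. *)
rewrite big_split /= (exchange_big_dep xpredT) //= addnCA [X in (_ <= X)%N]addnC leq_add2l.
rewrite -big_split /=; apply: leq_sum => s _.
by rewrite sum_nat_const hO mul1n -(dimv_diff_sub _ _ _ _ (secure_sub s)).
Qed.

(** A source entering [e] is recovered from its shrunk version and the key of [tail e], both of
    which are inputs of [e]. *)
Lemma adjust_edge e : (adjust (iedge P e) <= \sum_(i in inputs e) adjust i)%VS.
Proof.
apply: subv_trans (W_edge e) _; apply/subv_sumP => -[[s|f]|u] hi.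
- have ht : tail e \in O s by move: hi; rewrite !inE /= orbF.
  apply: subv_trans (adjust_src_sub s _ ht) _; rewrite subv_add.
  apply/andP; split; first exact: (sumv_sup (isrc P s)).
  by apply: (sumv_sup (inode P (tail e))) => //; rewrite !inE eqxx orbT.
- exact: (sumv_sup (iedge P f)).
- by apply: (sumv_sup (inode P u)) => //=; apply: addvSl.
Qed.

Lemma adjust_sink s u : u \in D s ->
  (adjust (isrc P s) <= \sum_(i in in_u P u) adjust i)%VS.
Proof.
move=> uD; case uO: (u \in O s); first by apply: (sumv_sup (isrc P s)); rewrite ?inE.
rewrite in_uE sumv_setU; apply: subv_trans (addvSr _ _).
have -> : (\sum_(i in in_edges u) adjust i = edge_space u)%VS.
  by apply: eq_bigr => i /imsetP[e _ ->].
apply: subv_trans (diffvSl _ _) (subv_trans (capvSr _ _) _).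
by rewrite (bigcapv_inf u) // uD uO.
Qed.

(** A common vector is a sum of [v i] from the secure parts and lies in [leak r]. Solving for one
    [v i] puts it in [leak_src r], which the secure part meets only in 0. *)
Lemma adjust_secret r :
  (\sum_(i in srcs P (WA r)) adjust i :&: \sum_(i in edges P (WB r)) adjust i)%VS = 0%VS.
Proof.
have -> : (\sum_(i in edges P (WB r)) adjust i = \sum_(i in edges P (WB r)) W i)%VS.
  by apply: eq_bigr => i /imsetP[e _ ->].
apply/eqP; rewrite -subv0; apply/subvP => x; rewrite memv_cap => /andP[xA xB].
case/memv_sumP: xA => v hv xE.
have adjW i : i \in srcs P (WA r) -> (adjust i <= W i)%VS.
  by case/imsetP => s _ ->; apply: secure_sub.
have xL : x \in leak r.
  rewrite memv_cap xB andbT xE; apply: memv_sumr => i hi.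
  exact: subvP (adjW i hi) _ (hv i hi).
rewrite xE memv0; apply/eqP; apply: big1 => i hi.
case/imsetP: (hi) => s hs ei.
have vZ : v i \in leak_src r s.
  rewrite memv_cap -ei (subvP (adjW i hi) _ (hv i hi)) /=.
  have -> : v i = x - \sum_(j in srcs P (WA r) :\ i) v j.
    by rewrite xE (big_setD1 i) //= addrK.
  apply: memv_add => //; rewrite memvN; apply: memv_sumr => j; rewrite !inE => /andP[_ hj].
  exact: subvP (adjW j hj) _ (hv j hj).
apply/eqP; rewrite -memv0 -(capv_diff (decodable s) (\sum_r leak_src r s)).
rewrite memv_cap; apply/andP; split; first by have := hv i hi; rewrite ei.
by apply: subvP vZ; apply: (sumv_sup r).
Qed.

End Adjust.

(** [K] depends on the network only, not on the field, the spaces or [d], so a small relative defect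
    yields a small relative loss. Keys are left out of the estimate: they absorb parts of sources,
    and rates and capacities do not involve them. *)
Lemma near_code_exists : exists K : nat, forall (F : fieldType) (vT : vectType F)
    (U : idx P -> {vspace vT}) (d : nat),
  (\sum_(i in SV P) \dim (U i) <= \dim (\sum_(i in SV P) U i)%VS + d)%N ->
  (forall e, (\dim (U (iedge P e) + \sum_(i in inputs e) U i)
     <= \dim (\sum_(i in inputs e) U i)%VS + d)%N) ->
  (forall s u, u \in D s -> (\dim (U (isrc P s) + \sum_(i in in_u P u) U i)
     <= \dim (\sum_(i in in_u P u) U i)%VS + d)%N) ->
  (forall r, (\dim (\sum_(i in srcs P (WA r)) U i
     :&: \sum_(i in edges P (WB r)) U i) <= d)%N) ->
  exists W : idx P -> {vspace vT},
    [/\ independent F vT (idx P) W (SV P),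
        forall e, (W (iedge P e) <= \sum_(i in inputs e) W i)%VS,
        forall s u, u \in D s -> (W (isrc P s) <= \sum_(i in in_u P u) W i)%VS,
        forall r, (\sum_(i in srcs P (WA r)) W i
                     :&: \sum_(i in edges P (WB r)) W i)%VS = 0%VS
      & forall i, i \notin [set inode P u | u : Nod P] ->
          (\dim (W i) <= \dim (U i) <= \dim (W i) + K * d)%N].
Proof.
(* [L * d] bounds the loss of one space under refinement. A span of at most [#|idx P|] of them then
   has defect at most [L' * d], and this is the defect with which the sources are adjusted. *)
pose L := (#|idx P|.+1 ^ #|Nod P|)%N; pose L' := (1 + #|idx P| * L)%N.
exists (L + (#|Nod P| + #|Adv P|) * L')%N => F vT U d hI hT hD hS.
have [V0 [sV0 eV0 iV0]] := independent_sub_exists F vT (idx P) U (SV P).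
pose V i := if i \in SV P then V0 i else U i.
have sVU i : (V i <= U i)%VS by rewrite /V; case: ifP.
have VU_loss i : (\dim (U i) <= \dim (V i) + d)%N.
  rewrite /V; case: ifP => hi; last by rewrite leq_addr.
  (* The total loss over [SV P] is at most [d] and no term grows, so no single term loses more than
     [d]. *)
  move: hI; rewrite -eV0 iV0 (bigD1 i) //= [in X in (_ <= X)%N](bigD1 i) //=.
  have : (\sum_(j in SV P | j != i) \dim (V0 j) <= \sum_(j in SV P | j != i) \dim (U j))%N.
    by apply: leq_sum => j _; apply: dimvS.
  move=> h1 h2; rewrite -(leq_add2r (\sum_(j in SV P | j != i) \dim (V0 j))).
  by apply: leq_trans (leq_trans _ h2) _; rewrite ?leq_add2l // addnAC.
have [W1 [W1V sW1 W1e W1L]] := refine_exists F vT U V d sVU VU_loss hT.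
have W1i : independent F vT (idx P) W1 (SV P).
  rewrite /independent; have e i : i \in SV P -> W1 i = V0 i by move=> hi; rewrite W1V // /V hi.
  by rewrite (eq_bigr _ e) iV0; apply: eq_bigr => i /e ->.
have sS (A : {set idx P}) : (\sum_(i in A) W1 i <= \sum_(i in A) U i)%VS.
  by apply/subv_sumP => i hi; apply: (sumv_sup i).
have W1s s u : u \in D s -> (\dim (W1 (isrc P s) + \sum_(i in in_u P u) W1 i)
     <= \dim (\sum_(i in in_u P u) W1 i)%VS + L' * d)%N.
  move=> /hD h.
  have /dimvS h1 := addvS (sW1 (isrc P s)) (sS (in_u P u)).
  have h2 := sumv_loss _ _ _ (index_enum (idx P)) (mem (in_u P u)) _ _ (fun=> (L * d)%N)
    (fun i _ => sW1 i) (fun i _ => W1L i).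
  apply: leq_trans h1 (leq_trans h _); apply: leq_trans (leq_add h2 (leqnn d)) _.
  rewrite -addnA leq_add2l /L' mulnDl mul1n addnC leq_add2l sum_nat_const -mulnA.
  by rewrite leq_mul2r max_card orbT.
have W1k r : (\dim (\sum_(i in srcs P (WA r)) W1 i
     :&: \sum_(i in edges P (WB r)) W1 i) <= L' * d)%N.
  apply: leq_trans (dimvS (capvS (sS _) (sS _))) (leq_trans (hS r) _).
  by rewrite leq_pmull.
exists (adjust F vT W1); split.
- exact: adjust_independent.
- exact: adjust_edge.
- exact: adjust_sink.
- exact: adjust_secret.
- case=> [[s|e]|u] hi.
  + rewrite (dimvS (subv_trans (secure_sub _ _ _ s) (sW1 _))) /=.
    apply: leq_trans (W1L _) _; rewrite mulnDl addnA [X in (_ <= X)%N]addnAC leq_add2r.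
    by have := secure_loss _ _ _ _ W1i W1e W1s W1k s; rewrite mulnA.
  + rewrite dimvS ?sW1 //=; apply: leq_trans (W1L _) _.
    by rewrite leq_add2l leq_mul2r leq_addr orbT.
  + by rewrite imset_f in hi.
Qed.

End Network.

(** * Only the uniform law has maximal entropy *)

Section MaximalEntropy.
Variable R : realType.

Lemma ln_lt_sub1 (t : R) : 0 < t -> t != 1 -> ln t < t - 1.
Proof.
move=> t0 t1; have := @expR_gt1Dx R (ln t); rewrite ln_eq0 // lnK ?posrE //.
by move=> /(_ t1); lra.
Qed.

Lemma max_entropy_uniform (T : finType) (m : T -> R) :
  (forall x, 0 <= m x) -> \sum_x m x = 1 ->
  \sum_x m x * (- ln (m x)) = ln #|T|%:R -> forall x, m x = #|T|%:R^-1.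
Proof.
move=> m0 m1 mH x0.
have M0 : 0 < #|T|%:R :> R by rewrite ltr0n; apply/card_gt0P; exists x0.
set M : R := #|T|%:R in mH M0 *.
(* Where [m x > 0], this is [m x * (t - 1 - ln t)] with [t = (m x * M)^-1], which vanishes only at
   [t = 1]; where [m x = 0] it is [M^-1 > 0]. The terms are nonnegative and sum to 0, so every [t]
   is 1. *)
pose g x := M^-1 - m x - m x * (- ln (m x) - ln M).
have gE x : 0 < m x -> g x = m x * ((m x * M)^-1 - 1 - ln (m x * M)^-1).
  move=> mx; rewrite lnV ?posrE ?mulr_gt0 // lnM ?posrE // /g.
  by rewrite invfM !mulrBr mulrA mulfV ?gt_eqF //; ring.
have g0 x : 0 <= g x.
  have [mx|] := ltP 0 (m x); last first.
    move=> mx; have e0 : m x = 0 by apply/le_anti; rewrite mx m0.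
    by rewrite /g e0 mul0r !subr0 invr_ge0 ltW.
  rewrite gE // mulr_ge0 // subr_ge0.
  have [->|t1] := eqVneq (m x * M)^-1 1; first by rewrite ln1 subrr.
  by apply/ltW/ln_lt_sub1; rewrite ?invr_gt0 ?mulr_gt0.
have : \sum_x g x = 0.
  rewrite /g !sumrB sumr_const -[M^-1 *+ _]mulr_natl -/M mulfV ?gt_eqF // m1.
  under eq_bigr do rewrite mulrBr.
  by rewrite sumrB mH -mulr_suml m1 mul1r !subrr.
move/psumr_eq0P => /(_ (fun x _ => g0 x)) /(_ x0 isT).
have [mx|] := ltP 0 (m x0); last first.
  move=> mx; have e0 : m x0 = 0 by apply/le_anti; rewrite mx m0.
  rewrite /g e0 mul0r !subr0 => /eqP; rewrite invr_eq0; move: M0 => /[swap] /eqP ->.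
  by rewrite ltxx.
rewrite gE // => /eqP; rewrite mulf_eq0 gt_eqF //= subr_eq0 => /eqP e.
have [t1|/ln_lt_sub1] := eqVneq (m x0 * M)^-1 1; last first.
  by rewrite e ltxx invr_gt0 mulr_gt0 // => /(_ isT).
by apply: (mulIf (lt0r_neq0 M0)); rewrite mulVf ?gt_eqF // -[LHS]invrK t1 invr1.
Qed.

Lemma max_entropy_uniform_rv (Om T : finType) (p : Om -> R) (X : Om -> T) :
  (forall w, 0 <= p w) -> \sum_w p w = 1 ->
  \sum_w p w * (- ln (\sum_(w' | X w' == X w) p w')) = ln #|T|%:R ->
  forall x, \sum_(w | X w == x) p w = #|T|%:R^-1.
Proof.
move=> p0 p1 pH; apply: max_entropy_uniform.
- by move=> x; apply: sumr_ge0.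
- by rewrite -p1 [RHS](partition_big X xpredT).
- rewrite -pH [RHS](partition_big X xpredT) //=; apply: eq_bigr => x _.
  by rewrite mulr_suml; apply: eq_bigr => w /eqP ->.
Qed.

End MaximalEntropy.

(** * Entropy and support of linear images of a uniform word *)

Lemma card_kernel_coset (F : finFieldType) (N m : nat) (A : 'M[F]_(N, m)) (x0 : 'rV[F]_N) :
  #|[pred x : 'rV[F]_N | (x - x0) *m A == 0]| = (#|F| ^ (N - \rank A))%N.
Proof.
rewrite -mxrank_ker -mxabelem.card_rowg -[RHS](card_imset _ (addIr x0)).
apply: eq_card => x; rewrite inE. apply/eqP/imsetP.
  by move=> h; exists (x - x0); rewrite ?subrK // mxabelem.mem_rowg; apply/sub_kermxP.
by case=> y; rewrite mxabelem.mem_rowg => /sub_kermxP h ->; rewrite addrK.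
Qed.

Lemma card_rV (F : finFieldType) N : #|{: 'rV[F]_N}| = (#|F| ^ N)%N.
Proof. by rewrite card_mx mul1n. Qed.

Section LinearModel.
Variables (P : problem) (R : realType) (F : finFieldType) (c : qcode P R F).
Local Notation Om := (Om P R F c).
Local Notation pr := (pr P R F c).
Local Notation dm := (dm P R F c).
Local Notation Y := (Y P R F c).
Variables (N : nat) (X : Om -> 'rV[F]_N) (A : forall i, 'M[F]_(N, dm i)).
Hypothesis pr_ge0 : forall w, 0 <= pr w.
Hypothesis X_unif : forall x, \sum_(w | X w == x) pr w = ((#|F| ^ N)%:R)^-1.
Hypothesis YX : forall i w, Y i w = X w *m A i.

Let qN_gt0 k : 0 < (#|F| ^ k)%:R :> R.
Proof. by rewrite ltr0n expn_gt0 (ltnW (card_finNzRing_gt1 F)). Qed.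

Lemma sum_pr_X (f : pred 'rV[F]_N) :
  \sum_(w | f (X w)) pr w = #|f|%:R / (#|F| ^ N)%:R.
Proof.
rewrite (partition_big X f) //= (eq_bigr (fun=> ((#|F| ^ N)%:R)^-1)).
  by rewrite sumr_const mulr_natl.
move=> x fx; rewrite -(X_unif x); apply: eq_bigl => w.
by case: eqP => [->|]; rewrite ?fx ?andbF.
Qed.

Lemma sum_pr1 : \sum_w pr w = 1.
Proof. by rewrite (sum_pr_X xpredT) card_rV divff // gt_eqF. Qed.

(** The sum of the column spaces of the [A i], transposed because subspaces are represented as row
    spaces. *)
Definition colspan (a : {set idx P}) : 'M[F]_N := (\sum_(i in a) <<(A i)^T>>)%MS.

Lemma agree_colspan a w w' : agree P R F c a w w' = ((X w' - X w) *m (colspan a)^T == 0).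
Proof.
set v := X w' - X w.
have -> : (v *m (colspan a)^T == 0) = (colspan a <= kermx v^T)%MS.
  by rewrite -(inj_eq trmx_inj) trmx_mul trmxK trmx0; apply/eqP/sub_kermxP.
apply/forallP/sumsmx_subP => h i.
  move=> hi; rewrite genmxE; apply/sub_kermxP; rewrite -trmx_mul.
  have /implyP/(_ hi)/eqP := h i; rewrite !YX => e.
  by rewrite mulmxBl e subrr trmx0.
apply/implyP => /h; rewrite genmxE => /sub_kermxP; rewrite -trmx_mul.
move/(congr1 trmx); rewrite trmxK trmx0 mulmxBl => /eqP; rewrite subr_eq0 eq_sym !YX.
by [].
Qed.

(** The words agreeing with a given one on [a] form a coset of a kernel of codimension
    [\rank (colspan a)]. So [prob_agree] is constant, and the entropy is minus its logarithm. *)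
Lemma entropy_colspan a : entropy P R F c a = (\rank (colspan a))%:R * ln #|F|%:R.
Proof.
have pE w : prob_agree P R F c a w = ((#|F| ^ \rank (colspan a))%:R)^-1.
  rewrite /prob_agree (eq_bigl _ _ (agree_colspan a w)).
  rewrite (sum_pr_X [pred x | (x - X w) *m (colspan a)^T == 0]) card_kernel_coset mxrank_tr.
  have rN : (\rank (colspan a) <= N)%N by exact: rank_leq_row.
  rewrite -[X in _ / (_ ^ X)%:R](subnK rN) expnD natrM invfM mulrA divff ?gt_eqF //.
  by rewrite mul1r.
rewrite /entropy; under eq_bigr do rewrite pE lnV ?posrE // opprK.
by rewrite -mulr_suml sum_pr1 mul1r natrX lnXn ?ltr0n ?(ltnW (card_finNzRing_gt1 F)) // mulr_natl.
Qed.

(** Every word has positive probability, so every vector of the row space of [A i] occurs. *)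
Lemma SP_rowg i : #|SP P R F c i| = (#|F| ^ \rank (A i))%N.
Proof.
rewrite -mxabelem.card_rowg; apply: eq_card => y; rewrite mxabelem.mem_rowg.
apply/imsetP/idP => [[w _ ->]|/submxP[x ->]]; first by rewrite YX submxMl.
have : \sum_(w | X w == x) pr w != 0 by rewrite X_unif invr_eq0 gt_eqF.
move=> /eqP /(psumr_neq0P (fun w _ => pr_ge0 w)) [w /andP[/eqP xw w0]].
by exists w; rewrite ?inE // YX xw.
Qed.

Lemma ln_SP i : ln #|SP P R F c i|%:R = (\rank (colspan [set i]))%:R * ln #|F|%:R :> R.
Proof.
rewrite SP_rowg /colspan big_set1 mxrank_gen mxrank_tr natrX.
by rewrite lnXn ?ltr0n ?(ltnW (card_finNzRing_gt1 F)) // mulr_natl.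
Qed.

End LinearModel.

(** * Every code is a linear image of a uniform word *)

Section CodeModel.
Variables (P : problem) (R : realType) (F : finFieldType) (c : qcode P R F).
Hypothesis hacyc : acyclic P.
Hypothesis hc : is_qlin_code P R F c.
Local Notation Om := (Om P R F c).
Local Notation pr := (pr P R F c).
Local Notation dm := (dm P R F c).
Local Notation Y := (Y P R F c).

Definition iroot (j : Src P + Nod P) : idx P :=
  match j with inl s => isrc P s | inr u => inode P u end.

(** A coordinate is a source or key together with a position in its vector; [root_word] concatenates
    these vectors. *)
Definition coord : finType := {j : Src P + Nod P & 'I_(dm (iroot j))}.

Definition coord_at (j : Src P + Nod P) (l : 'I_(dm (iroot j))) : coord :=
  Tagged (fun j => 'I_(dm (iroot j))) l.

Definition root_word (w : Om) : 'rV[F]_#|coord| :=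
  \row_k Y (iroot (tag (enum_val k))) w 0 (tagged (enum_val k)).

Lemma iroot_SV j : iroot j \in SV P.
Proof. by case: j => x; rewrite inE. Qed.

Lemma agree_root_word w w' : agree P R F c (SV P) w w' = (root_word w' == root_word w).
Proof.
apply/forallP/eqP => [h|h i].
  apply/rowP => k; rewrite !mxE; set x := enum_val k.
  by have /implyP/(_ (iroot_SV (tag x)))/eqP -> := h (iroot (tag x)).
have e j : Y (iroot j) w == Y (iroot j) w'.
  apply/eqP/rowP => l; move/rowP: h => /(_ (enum_rank (coord_at j l))).
  by rewrite !mxE enum_rankK.
apply/implyP; case: i => [[s|f]|u]; rewrite inE // => _; [exact: (e (inl s)) | exact: (e (inr u))].
Qed.

Lemma entropy_root i : i \in SV P -> entropy P R F c [set i] = (dm i)%:R * ln #|F|%:R.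
Proof.
move: hc => [p0 [p1 [pU _]]] hi.
have q0 : (0 < #|F|)%N by exact: ltnW (card_finNzRing_gt1 F).
have e w : prob_agree P R F c [set i] w = ((#|F| ^ dm i)%:R)^-1.
  rewrite -(pU i hi (Y i w)); apply: eq_bigl => w'.
  apply/forallP/eqP => [/(_ i)|h j]; first by rewrite inE eqxx => /eqP.
  by apply/implyP; rewrite inE => /eqP ->; rewrite h.
rewrite /entropy; under eq_bigr do rewrite e lnV ?posrE ?ltr0n ?expn_gt0 ?q0 // opprK.
by rewrite -mulr_suml p1 mul1r natrX lnXn ?ltr0n // mulr_natl.
Qed.

Lemma card_coord : #|coord| = (\sum_j dm (iroot j))%N.
Proof.
rewrite card_tagged sumnE big_map big_enum /=; apply: eq_bigr => j _.
by rewrite card_ord.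
Qed.

(** Uniformity is given for each source and key separately. [C_I] adds their entropies up to
    [#|coord| * ln #|F|], the maximum for words of this length, which forces joint uniformity. *)
Lemma root_word_unif x : \sum_(w | root_word w == x) pr w = ((#|F| ^ #|coord|)%:R)^-1.
Proof.
rewrite -card_rV; apply: max_entropy_uniform_rv; move: (hc) => [p0 [p1 [_ [_ [hI _]]]]] //.
have <- : entropy P R F c (SV P) = ln #|{: 'rV[F]_#|coord|}|%:R.
  rewrite hI card_rV natrX lnXn ?ltr0n ?(ltnW (card_finNzRing_gt1 F)) //.
  rewrite card_coord -[RHS]mulr_natl natr_sum big_sumType /= mulrDl !mulr_suml.
  by congr (_ + _); apply: eq_bigr => i _; rewrite entropy_root // inE.
by apply: eq_bigr => w _; congr (_ * - ln _); apply: eq_bigl => w'; rewrite agree_root_word.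
Qed.

Lemma root_word_Y j w : Y (iroot j) w
  = root_word w *m \matrix_(k, l) (enum_val k == coord_at j l)%:R.
Proof.
apply/rowP => l; rewrite mxE (bigD1 (enum_rank (coord_at j l))) //= big1.
  by rewrite !mxE enum_rankK eqxx mulr1 addr0.
move=> k hk; rewrite !mxE; case: eqP => [e|]; last by rewrite mulr0.
by rewrite -e enum_valK eqxx in hk.
Qed.

Lemma edge_root_word e :
  exists A : 'M[F]_(#|coord|, dm (iedge P e)), forall w, Y (iedge P e) w = root_word w *m A.
Proof.
elim/(edge_ind P hacyc): e => e IH.
have hA i : exists A : 'M[F]_(#|coord|, dm i), i \in inputs P e ->
    forall w, Y i w = root_word w *m A.
  case: i => [[s|f]|u].
  - by eexists => _ w; apply: (root_word_Y (inl s)).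
  - case hf: (tail e \in Defs.head f); first by have [A hA] := IH f hf; exists A.
    (* A dummy matrix for an edge that is not an input of [e], since the choice of [A] ranges over
       all indices. *)
    by exists 0; rewrite !inE /= hf.
  - by eexists => _ w; apply: (root_word_Y (inr u)).
pose A i := projT1 (cid (hA i)).
exists (\sum_(i in inputs P e) A i *m phi P R F c e i) => w.
move: hc => [_ [_ [_ [-> _]]]]; rewrite mulmx_sumr; apply: eq_bigr => i hi.
by rewrite mulmxA (projT2 (cid (hA i)) hi w).
Qed.

Lemma code_model_exists : exists (N : nat) (X : Om -> 'rV[F]_N) (A : forall i, 'M[F]_(N, dm i)),
  (forall x, \sum_(w | X w == x) pr w = ((#|F| ^ N)%:R)^-1) /\
  (forall i w, Y i w = X w *m A i).
Proof.
have hA i : exists A : 'M[F]_(#|coord|, dm i), forall w, Y i w = root_word w *m A.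
  case: i => [[s|f]|u]; last 1 first.
  - by eexists => w; apply: (root_word_Y (inr u)).
  - by eexists => w; apply: (root_word_Y (inl s)).
  - exact: edge_root_word.
exists #|coord|, root_word, (fun i => projT1 (cid (hA i))); split.
  exact: root_word_unif.
by move=> i w; rewrite {1}(projT2 (cid (hA i)) w).
Qed.

End CodeModel.

(** * From codes to representable functions *)

Import VectorInternalTheory.

Lemma vs2mx_sumv (F : fieldType) (vT : vectType F) (I : finType) (a : {set I})
    (W : I -> {vspace vT}) :
  vs2mx (\sum_(i in a) W i)%VS = (\sum_(i in a) vs2mx (W i))%MS.
Proof.
apply: (big_morph vs2mx); last by rewrite /= linear0 genmx0.
by move=> U V; rewrite /= genmx_adds !gen_vs2mx.
Qed.

Lemma mx_family_vspace (F : fieldType) (I : finType) (N : nat) (B : I -> 'M[F]_N) :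
  exists (n : nat) (U : I -> {vspace 'rV[F]_n}), forall a : {set I},
    \dim (\sum_(i in a) U i)%VS = \rank (\sum_(i in a) B i)%MS.
Proof.
(* A subspace of ['rV[F]_N] is stored as a matrix of size [dim 'rV[F]_N], equal to [N] only
   propositionally, so the family is transported along that equality. *)
suff h k : N = k -> exists B' : I -> 'M[F]_k, forall a : {set I},
    \rank (\sum_(i in a) B' i)%MS = \rank (\sum_(i in a) B i)%MS.
  have [|B' hB'] := h (dim 'rV[F]_N); first by rewrite dim_matrix mul1r.
  exists N, (fun i => mx2vs (B' i)) => a; rewrite /dimv vs2mx_sumv -hB' /=.
  by rewrite -genmx_sums mxrank_gen.
by case: k /; exists B.
Qed.

Lemma q_rep_code (P : problem) (R : realType) (F : finFieldType) (c : qcode P R F) :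
  acyclic P -> is_qlin_code P R F c ->
  exists h : {set idx P} -> R, [/\ q_rep P R F h,
    forall a, entropy P R F c a = h a * ln #|F|%:R
  & forall i, ln #|SP P R F c i|%:R = h [set i] * ln #|F|%:R].
Proof.
move=> hacyc hc; have [N [X [A [X_unif YX]]]] := code_model_exists P R F c hacyc hc.
exists (fun a => (\rank (colspan P R F c N A a))%:R); split.
- have [n [U hU]] := mx_family_vspace F (idx P) N (fun i => <<(A i)^T>>%MS).
  by exists n, U => a; rewrite hU.
- by move=> a; apply: entropy_colspan X_unif YX a.
- move=> i; apply: ln_SP X_unif YX i; by case: hc.
Qed.

(** * The code defined by a family of subspaces *)

Section CodeOfSubspaces.
Variables (P : problem) (R : realType) (F : finFieldType) (vT : vectType F).
Variable W : idx P -> {vspace vT}.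
Hypothesis W_indep : independent F vT (idx P) W (SV P).
Hypothesis W_edge : forall e, (W (iedge P e) <= \sum_(i in inputs P e) W i)%VS.

Definition basis_mx (i : idx P) : 'M[F]_(\dim (W i), dim vT) := row_base (vs2mx (W i)).

(** Writing the basis of the edge space in the bases of the input spaces gives the blocks of the
    encoding map. *)
Lemma edge_blocks_exist e : exists phi : forall i, 'M[F]_(\dim (W i), \dim (W (iedge P e))),
  (basis_mx (iedge P e))^T = \sum_(i in inputs P e) (basis_mx i)^T *m phi i.
Proof.
have : (basis_mx (iedge P e) <= \sum_(i in inputs P e) vs2mx (W i))%MS.
  by rewrite -vs2mx_sumv eq_row_base; apply: W_edge.
case/sub_sumsmxP => u_ ->.
exists (fun i => (u_ i *m col_base (vs2mx (W i)))^T); rewrite raddf_sum /=.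
by apply: eq_bigr => i _; rewrite -trmx_mul -mulmxA mulmx_base.
Qed.

(** The outcome [w] is a uniform word, and [Y i] lists its inner products with a basis of [W i]. *)
Definition subspace_code : qcode P R F := @QCode P R F 'rV[F]_(dim vT)
  (fun=> ((#|F| ^ dim vT)%:R)^-1) (fun i => \dim (W i))
  (fun i w => w *m (basis_mx i)^T)
  (fun e i => projT1 (cid (edge_blocks_exist e)) i).

Let X_unif (x : 'rV[F]_(dim vT)) :
  \sum_(w : Om P R F subspace_code | id w == x) pr P R F subspace_code w
  = ((#|F| ^ dim vT)%:R)^-1.
Proof. by rewrite (big_pred1 x). Qed.

Let pr_ge0 w : 0 <= pr P R F subspace_code w.
Proof. by rewrite invr_ge0 ler0n. Qed.

Let rank_colspan a :
  \rank (colspan P R F subspace_code (dim vT) (fun i => (basis_mx i)^T) a)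
  = \dim (\sum_(i in a) W i)%VS.
Proof.
rewrite /dimv vs2mx_sumv /colspan -(mxrank_gen (\sum_(i in a) vs2mx (W i))%MS) genmx_sums.
congr (\rank _); apply: eq_bigr => i _; rewrite trmxK.
by apply/eq_genmx/eq_row_base.
Qed.

Lemma entropy_subspace_code a :
  entropy P R F subspace_code a = (\dim (\sum_(i in a) W i)%VS)%:R * ln #|F|%:R.
Proof. by rewrite -rank_colspan; apply: entropy_colspan => // x; exact: X_unif. Qed.

Lemma ln_SP_subspace_code i :
  ln #|SP P R F subspace_code i|%:R = (\dim (W i))%:R * ln #|F|%:R :> R.
Proof.
have -> : \dim (W i) = \dim (\sum_(j in [set i]) W j)%VS by rewrite big_set1.
rewrite -rank_colspan; apply: ln_SP => // x; exact: X_unif.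
Qed.

Lemma C_I_subspace_code : C_I P R (entropy P R F subspace_code).
Proof.
rewrite /C_I; under [in RHS]eq_bigr do rewrite entropy_subspace_code big_set1.
under [in X in _ + X]eq_bigr do rewrite entropy_subspace_code big_set1.
by rewrite entropy_subspace_code W_indep big_SV natrD !natr_sum mulrDl !mulr_suml.
Qed.

Lemma cond_subspace_code i (a : {set idx P}) : (W i <= \sum_(j in a) W j)%VS ->
  cond P R (entropy P R F subspace_code) [set i] a = 0.
Proof.
by move=> /addv_idPr h; rewrite /cond !entropy_subspace_code sumv_setU big_set1 h subrr.
Qed.

Lemma meet_subspace_code (a b : {set idx P}) :
  (\sum_(j in a) W j :&: \sum_(j in b) W j)%VS = 0%VS ->
  meet P R (entropy P R F subspace_code) a b = 0.
Proof.
move=> h; rewrite /meet !entropy_subspace_code sumv_setU -mulrDl -mulrBl -natrD.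
by rewrite -dimv_sum_cap h dimv0 addn0 subrr mul0r.
Qed.

Lemma is_qlin_subspace_code : is_qlin_code P R F subspace_code.
Proof.
split; first exact: pr_ge0.
split; first exact: (sum_pr1 P R F subspace_code (dim vT) id X_unif).
split.
  (* The basis vectors are free, so the map from [w] to [Y i] is onto and its fibres are cosets of
     one kernel, hence equally likely. *)
  move=> i _ y; have full : row_full (basis_mx i)^T.
    by rewrite /row_full mxrank_tr; apply: row_base_free.
  have yE : y = (y *m pinvmx (basis_mx i)^T) *m (basis_mx i)^T.
    by rewrite mulmxKpV // submx_full.
  rewrite (eq_bigl (fun w => (w - y *m pinvmx (basis_mx i)^T) *m (basis_mx i)^T == 0)).
    rewrite (sum_pr_X P R F subspace_code (dim vT) id X_unif
      [pred w | (w - y *m pinvmx (basis_mx i)^T) *m (basis_mx i)^T == 0]).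
    rewrite card_kernel_coset (eqP full).
    have rN : (\dim (W i) <= dim vT)%N by exact: rank_leq_row.
    rewrite -[X in _ / (_ ^ X)%:R](subnK rN) expnD natrM invfM mulrA divff ?mul1r //.
    by rewrite pnatr_eq0 -lt0n expn_gt0 (ltnW (card_finNzRing_gt1 F)).
  by move=> w /=; rewrite mulmxBl -yE subr_eq0.
split.
  move=> e w /=; case: (cid (edge_blocks_exist e)) => f /= ->; rewrite mulmx_sumr.
  by apply: eq_bigr => i _; rewrite mulmxA.
split; first exact: C_I_subspace_code.
by move=> e; apply: cond_subspace_code.
Qed.

End CodeOfSubspaces.

(** * Codes approximating an almost representable function *)

Lemma leq_add_truncn (R : realType) (m n : nat) (x : R) :
  m%:R - n%:R <= x -> 0 <= x -> (m <= n + Num.truncn x)%N.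
Proof.
move=> hx x0; have [mn|nm] := leqP m n; first exact: leq_trans mn (leq_addr _ _).
by rewrite -leq_subLR truncn_ge_nat // natrB // ltnW.
Qed.

Lemma approx_code_exists (P : problem) (R : realType) (F : finFieldType)
    (h : {set idx P} -> R) (eps : R) :
  acyclic P -> (forall s : Src P, #|O s| = 1%N) ->
  almost_q_rep P R F h -> C_I P R h -> C_T P R h -> C_D P R h -> C_S P R h -> 0 < eps ->
  exists (c : qcode P R F) (a : R),
    [/\ is_qlin_code P R F c, 0 < a, C_D P R (entropy P R F c), C_S P R (entropy P R F c)
      & forall i, i \notin [set inode P u | u : Nod P] ->
          `|a * ln #|SP P R F c i|%:R - h [set i]| <= eps].
Proof.
move=> hacyc hO [hs [hs_weak hs_cvg]] hI hT hD hS eps0.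
have [K hK] := near_code_exists P hacyc hO.
(* With each value of [h] off by at most [eta], a conditional term accumulates 2 errors, a mutual
   information 3, and [C_I] at most [#|idx P| + 1]; [M] covers all cases. The denominator of [eta]
   makes the final error [eta + K * M * eta] equal to [eps]. *)
pose M : R := (#|idx P| + 3)%:R; pose eta := eps / (1 + K%:R * M).
have M3 : 3%:R + #|idx P|%:R = M by rewrite addrC -natrD.
have den0 : 0 < 1 + K%:R * M by rewrite ltr_pwDl // mulr_ge0 // ler0n.
have eta0 : 0 < eta by rewrite divr_gt0.
have [n hn] : exists n, forall a : {set idx P}, `|h a - hs n a| <= eta.
  have near_h (a : {set idx P}) : (\forall n \near \oo, `|h a - hs n a| <= eta)%classic.
    by move/cvgrPdist_le: (hs_cvg a) => /(_ eta eta0).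
  have near_all := @filter_forall _ _
    (fun (a : {set idx P}) n => `|h a - hs n a| <= eta) _ _ near_h.
  by case: (filter_ex (near_all _)) => n hn; exists n.
have [C [C0 [n' [U hU]]]] := hs_weak n.
pose g (a : {set idx P}) : R := (\dim (\sum_(i in a) U i)%VS)%:R.
(* [C] clears the scale of [hs n], so the rank function [g] follows [C * h] within [C * eta]. *)
have gh a : C * h a - C * eta <= g a <= C * h a + C * eta.
  rewrite /g -hU -mulrBr -mulrDr !ler_pM2l //; move: (hn a); rewrite ler_norml => /andP[].
  by move=> ? ?; apply/andP; split; lra.
have g1 i : g [set i] = (\dim (U i))%:R by rewrite /g big_set1.
have Ce0 : 0 <= C * eta by rewrite mulr_ge0 // ltW.
have CM : 3%:R * (C * eta) <= C * eta * M.
  by rewrite mulrC ler_wpM2l // -M3 lerDl ler0n.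
have x0 : 0 <= C * eta * M by rewrite mulr_ge0 // ler0n.
pose d := Num.truncn (C * eta * M).
have condd i (a : {set idx P}) : cond P R h [set i] a = 0 ->
    (\dim (U i + \sum_(j in a) U j) <= \dim (\sum_(j in a) U j)%VS + d)%N.
  rewrite /cond => /eqP; rewrite subr_eq0 => /eqP e; apply: leq_add_truncn => //.
  have -> : (\dim (U i + \sum_(j in a) U j)%VS)%:R = g ([set i] :|: a).
    by rewrite /g sumv_setU big_set1.
  rewrite -/(g a); move: (gh ([set i] :|: a)) (gh a); rewrite e.
  by move=> /andP[_ h1] /andP[h2 _]; lra.
have [] := hK F 'rV[F]_n' U d.
- apply: leq_add_truncn => //; rewrite -/(g (SV P)).
  have : \sum_(i in SV P) (\dim (U i))%:R <= \sum_(i in SV P) (C * h [set i] + C * eta).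
    by apply: ler_sum => i _; rewrite -g1; case/andP: (gh [set i]).
  rewrite big_split /= -mulr_sumr sumr_const natr_sum.
  have -> : \sum_(i in SV P) h [set i] = h (SV P) by rewrite big_SV hI.
  have cS : C * eta *+ #|SV P| <= C * eta * #|idx P|%:R.
    by rewrite -mulr_natr ler_wpM2l // ler_nat max_card.
  case/andP: (gh (SV P)) => h1 _ h2.
  have : C * eta * M = 3%:R * (C * eta) + C * eta * #|idx P|%:R by rewrite -M3; ring.
  by lra.
- by move=> e; apply: condd; apply: hT.
- by move=> s u us; apply: condd; apply: hD.
- move=> r; rewrite -[X in (_ <= X)%N]add0n; apply: leq_add_truncn => //.
  have := dimv_sum_cap (\sum_(i in srcs P (WA r)) U i)%VS (\sum_(i in edges P (WB r)) U i)%VS.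
  move/(congr1 (fun k => k%:R : R)); rewrite !natrD -sumv_setU.
  rewrite -/(g (srcs P (WA r))) -/(g (edges P (WB r))).
  rewrite -/(g (srcs P (WA r) :|: edges P (WB r))) => e.
  have := hS r; rewrite /meet => m0.
  have : C * h (srcs P (WA r)) + C * h (edges P (WB r))
      - C * h (srcs P (WA r) :|: edges P (WB r)) = 0 by rewrite -mulrDr -mulrBr m0 mulr0.
  move: (gh (srcs P (WA r))) (gh (edges P (WB r))) (gh (srcs P (WA r) :|: edges P (WB r))).
  by move=> /andP[? ?] /andP[? ?] /andP[? ?] ?; lra.
move=> W [W_indep W_edge W_sink W_secret W_dim].
have q1 : 0 < ln #|F|%:R :> R by rewrite ln_gt0 // ltr1n card_finNzRing_gt1.
(* The scale undoes both [C] and the factor [ln #|F|] between dimensions and entropies. *)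
exists (subspace_code P R F _ W W_edge), (C * ln #|F|%:R)^-1; split.
- exact: is_qlin_subspace_code.
- by rewrite invr_gt0 mulr_gt0.
- by move=> s u us; apply: cond_subspace_code; apply: W_sink.
- by move=> r; apply: meet_subspace_code.
move=> i hi; rewrite ln_SP_subspace_code.
have -> : (C * ln #|F|%:R)^-1 * ((\dim (W i))%:R * ln #|F|%:R) - h [set i]
    = C^-1 * ((\dim (W i))%:R - C * h [set i]).
  by field; rewrite !gt_eqF.
rewrite normrM gtr0_norm ?invr_gt0 // ler_pdivrMl //.
have /andP[] := W_dim i hi; rewrite -!(ler_nat R) natrD natrM -g1.
have : d%:R <= C * eta * M by rewrite truncn_le.
move/(ler_wpM2l (ler0n R K)); case/andP: (gh [set i]).
(* The distance from [\dim (W i)] to [C * h [set i]] combines the approximation error [C * eta] with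
   the repair loss [K * d]. *)
have : C * eta + K%:R * (C * eta * M) = C * eps.
  by rewrite /eta; field; rewrite gt_eqF.
by move=> ? ? ? ? ? ?; rewrite ler_norml; apply/andP; split; lra.
Qed.

Lemma cvg_dist_harmonic (R : realType) (u v : nat -> R) (l : R) :
  (forall n, `|v n - u n| <= harmonic n) ->
  (u @ \oo --> l)%classic -> (v @ \oo --> l)%classic.
Proof.
move=> uv ul.
have c1 : ((fun n => u n - harmonic n) @ \oo --> l)%classic.
  by rewrite -[l]subr0; apply: cvgB => //; apply: cvg_harmonic.
have c2 : ((fun n => u n + harmonic n) @ \oo --> l)%classic.
  by rewrite -[l]addr0; apply: cvgD => //; apply: cvg_harmonic.
apply: squeeze_cvgr c1 c2; near=> n.
by have := uv n; rewrite ler_norml => /andP[? ?]; apply/andP; split; lra.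
Unshelve. all: by end_near.
Qed.

(** * The two inclusions *)

Theorem theorem9 (P : problem) (R : realType) (q : nat) (F : finFieldType)
  (hacyc : acyclic P)
  (hO : forall s : Src P, #|O s| = 1%N)
  (hq : exists p k : nat, prime p /\ (0 < k)%N /\ q = (p ^ k)%N)
  (hF : #|F| = q)
  (lam : Src P -> R) (om : Edg P -> R)
  (hlam : forall s, 0 <= lam s) (hom : forall e, 0 <= om e) :
  achievable_qlin_strong P R F (lam, om) <->
  CL P R (proj_set P R (fun h : {set idx P} -> R =>
        almost_q_rep P R F h /\ C_I P R h /\ C_T P R h /\ C_D P R h /\ C_S P R h))
    (lam, om).
Proof.
have q1 : 0 < ln #|F|%:R :> R by rewrite ln_gt0 // ltr1n card_finNzRing_gt1.
split=> [[cs [cn [hcs [cn0 [hE [hS [hDec hSec]]]]]]]|[tn [cn [htn [cn0 [hE hS]]]]]].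
  (* From codes to functions: entropies are [ln #|F|] times the rank functions [h n]. The
     constraints are homogeneous, so they pass to [h n], and the factor moves into the scaling
     sequence. *)
  have /choice[h hh] := fun n => q_rep_code P R F (cs n) hacyc (hcs n).
  exists (fun n => (fun s => h n [set isrc P s], fun e => h n [set iedge P e])).
  exists (fun n => cn n * ln #|F|%:R).
  have cancel_ln x : x * ln #|F|%:R = 0 -> x = 0 :> R.
    by move/eqP; rewrite mulf_eq0 (gt_eqF q1) orbF => /eqP.
  split; last split; last split.
  - move=> n; exists (h n); split=> //; have [h_rep h_ent _] := hh n.
    have [_ [_ [_ [_ [hI hT]]]]] := hcs n.
    split.
      exists (fun=> h n); split=> [_|a]; last exact: cvg_cst.
      exists 1; split=> //; case: h_rep => k [U hU]; exists k, U => a; by rewrite mul1r.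
    split.
      move: hI; rewrite /C_I h_ent.
      under eq_bigr do rewrite h_ent; under [X in _ + X]eq_bigr do rewrite h_ent.
      by rewrite -!mulr_suml -mulrDl => /(mulIf (lt0r_neq0 q1)).
    split=> [e|].
      by have := hT e; rewrite /cond !h_ent -mulrBl => /cancel_ln.
    split=> [s u us|r].
      by have := hDec n s u us; rewrite /cond !h_ent -mulrBl => /cancel_ln.
    by have := hSec n r; rewrite /meet !h_ent -mulrDl -mulrBl => /cancel_ln.
  - by move=> n; rewrite mulr_gt0.
  - move=> e; have [l [ul le]] := hE e; exists l; split=> //.
    rewrite (_ : (fun n => _) = (fun n => cn n * ln #|SP P R F (cs n) (iedge P e)|%:R)) //.
    by apply/funext => n; have [_ _ ->] := hh n; rewrite /= mulrAC mulrA.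
  - move=> s; have [l [ul le]] := hS s; exists l; split=> //.
    rewrite (_ : (fun n => _) = (fun n => cn n * ln #|SP P R F (cs n) (isrc P s)|%:R)) //.
    by apply/funext => n; have [_ _ ->] := hh n; rewrite /= mulrAC mulrA.
(* From functions to codes: the [n]-th function is replaced by an exact code whose rescaled rates
   and capacities differ from the given ones by at most [harmonic n], which tends to 0 and leaves
   the limits unchanged. *)
have /choice[ca hca] : forall n, exists ca : qcode P R F * R,
    [/\ is_qlin_code P R F ca.1, 0 < ca.2,
        C_D P R (entropy P R F ca.1), C_S P R (entropy P R F ca.1)
      & (forall s, `|cn n * ca.2 * ln #|SP P R F ca.1 (isrc P s)|%:R - cn n * (tn n).1 s|
           <= harmonic n) /\
        (forall e, `|cn n * ca.2 * ln #|SP P R F ca.1 (iedge P e)|%:R - cn n * (tn n).2 e|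
           <= harmonic n)].
  move=> n; have [h [[h_rep [hI [hT [hD hSc]]]] [hs he]]] := htn n.
  (* Dividing by [cn n] anticipates the later multiplication by it; the sequence [cn] may be
     unbounded. *)
  have eps0 : 0 < harmonic n / cn n :> R by rewrite divr_gt0 // harmonic_gt0.
  have [c [a [c_lin a0 cD cS hc]]] :=
    approx_code_exists P R F h _ hacyc hO h_rep hI hT hD hSc eps0.
  have hc' i : i \notin [set inode P u | u : Nod P] ->
      `|cn n * a * ln #|SP P R F c i|%:R - cn n * h [set i]| <= harmonic n.
    move=> /hc; rewrite ler_pdivlMr // => hle.
    by rewrite -mulrA -mulrBr normrM gtr0_norm // mulrC.
  exists (c, a); split=> //=; split=> [s|e]; rewrite ?hs ?he; apply: hc';
    by apply/negP => /imsetP[x _].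
exists (fun n => (ca n).1), (fun n => cn n * (ca n).2); split; last split; last split; last split.
- by move=> n; case: (hca n).
- by move=> n; case: (hca n) => _ a0 _ _ _; rewrite mulr_gt0.
- move=> e; have [l [ul le]] := hE e; exists l; split=> //.
  by apply: cvg_dist_harmonic ul => n; have [_ _ _ _ [_ ->]] := hca n.
- move=> s; have [l [ul le]] := hS s; exists l; split=> //.
  by apply: cvg_dist_harmonic ul => n; have [_ _ _ _ [-> _]] := hca n.
- by split=> n; case: (hca n).
Qed.
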